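(* Let $R$ be a ring of characteristic zero such that $\mathrm{Char}(R/J(R))\neq 0$. Then $R$ has infinitely many maximal subrings up to isomorphism.
   Context: All rings are commutative with $1\neq 0$; subrings and homomorphisms are unital. $J(R)$ is the Jacobson radical of $R$ and $\mathrm{Char}$ denotes the characteristic of a ring. A proper subring $S$ of $R$ is a maximal subring of $R$ if it is maximal with respect to inclusion among the proper subrings of $R$. ''Up to isomorphism'' means that subrings are counted up to ring isomorphism. *)

(* Defs.v *)
From HB Require Import structures.
From mathcomp Require Import all_boot all_algebra ring_quotient.
From mathcomp Require Import boolp classical_sets functions cardinality.

Set Implicit Arguments.
Unset Strict Implicit.
Unset Printing Implicit Defensive.
Import GRing.Theory.

Local Open Scope ring_scope.
Local Open Scope classical_set_scope.

(* [pchar R] only records prime characteristics, whereas the characteristic of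
   a ring that is not a domain may be composite. *)
Definition ring_char (R : nzRingType) : nat :=
  if pselect (exists n, (0 < n)%N && (n%:R == 0 :> R)) is left ex_n
  then ex_minn ex_n else 0.

Lemma ring_charP (R : nzRingType) (n : nat) :
  (n%:R == 0 :> R) = (ring_char R %| n)%N.
Proof.
rewrite /ring_char; case: pselect => [ex_n|no_n].
  case: ex_minnP => m /andP[m_gt0 /eqP m0] m_min.
  have mod_n : (n%:R : R) = (n %% m)%:R.
    by rewrite {1}(divn_eq n m) natrD natrM m0 mulr0 add0r.
  rewrite mod_n /dvdn; apply/idP/idP => [r0|/eqP->//].
  rewrite -leqn0 leqNgt; apply/negP => r_gt0.
  have := m_min (n %% m)%N; rewrite r_gt0 r0 => /(_ isT).
  by rewrite leqNgt ltn_mod m_gt0.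
rewrite dvd0n; apply/idP/idP => [n0|/eqP->//].
case: n n0 => // n n0; case: no_n; by exists n.+1.
Qed.

(* The ideals of type [idealr R] are proper by definition. *)
Definition maximal_ideal (R : comNzRingType) (M : idealr R) : Prop :=
  forall I : idealr R, {subset M <= I} -> {subset I <= M}.

Definition jacobson (R : comNzRingType) : {pred R} :=
  fun x => `[< forall M : idealr R, maximal_ideal M -> x \in M >].

Section JacobsonQuotient.
Variable R : comNzRingType.

Definition ideal_mk (A : {pred R}) (hA : idealr_closed A) : idealr R :=
  HB.pack_for (idealr R) (A : R -> bool) (isIdealr.Build R A hA).

Lemma idealr_closedP (I : idealr R) : idealr_closed (I : {pred R}).
Proof.
split=> [||a u v uI vI]; first exact: rpred0.
  by rewrite idealr1.
by rewrite rpredD // idealMr.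
Qed.

Lemma idealr_closed0 : idealr_closed (pred1 (0 : R)).
Proof.
split=> [||a u v]; rewrite ?inE ?oner_eq0 //.
by move=> /eqP-> /eqP->; rewrite mulr0 addr0.
Qed.

Lemma maximal_ideal_exists : exists M : idealr R, maximal_ideal M.
Proof.
pose le (I J : idealr R) := `[< {subset I <= J} >].
case: (@ZL_preorder _ (ideal_mk idealr_closed0) le).
- by move=> I; apply/asboolP.
- move=> I J K /asboolP JI /asboolP IK.
  by apply/asboolP => x /JI /IK.
- move=> A totA; have [[I0 AI0]|A0] := pselect (exists I, A I); last first.
    exists (ideal_mk idealr_closed0) => I AI; by case: A0; exists I.
  pose U : {pred R} := fun x => `[< exists2 I, A I & x \in (I : idealr R) >].
  have U_closed : idealr_closed U.
    split=> [||a u v].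
    + by apply/asboolP; exists I0 => //; apply: rpred0.
    + by apply/negP => /asboolP[I _]; rewrite idealr1.
    move=> /asboolP[I AI uI] /asboolP[J AJ vJ]; apply/asboolP.
    have [/asboolP IJ|/asboolP JI] := totA _ _ AI AJ.
    + by exists J => //; rewrite rpredD // idealMr // IJ.
    + by exists I => //; rewrite rpredD // ?idealMr // JI.
  exists (ideal_mk U_closed) => I AI; apply/asboolP => x xI.
  by apply/asboolP; exists I.
move=> M maxM; exists M => I MI.
by apply/asboolP; apply: maxM; apply/asboolP.
Qed.

Lemma jacobson_closed : idealr_closed (@jacobson R).
Proof.
split=> [||a u v /asboolP uJ /asboolP vJ].
- by apply/asboolP => M _; apply: rpred0.
- have [M maxM] := maximal_ideal_exists.
  by apply/negP => /asboolP /(_ M maxM); rewrite idealr1.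
- by apply/asboolP => M maxM; rewrite rpredD ?idealMr ?uJ ?vJ.
Qed.

HB.instance Definition _ := isIdealr.Build R (@jacobson R) jacobson_closed.

End JacobsonQuotient.

(* The carrier of a subring, as a ring in its own right. *)
Record subring_of (R : comNzRingType) (S : subringClosed R) := SubringOf {
  subring_val : R;
  subring_valP : subring_val \in S
}.

Section SubringOf.
Variables (R : comNzRingType) (S : subringClosed R).
HB.instance Definition _ := [isSub of subring_of S for @subring_val R S].
HB.instance Definition _ := [Choice of subring_of S by <:].
HB.instance Definition _ :=
  [SubChoice_isSubComNzRing of subring_of S by <:].
End SubringOf.

Definition subring_iso (R : comNzRingType) (S T : subringClosed R) : Prop :=
  exists f : {rmorphism subring_of S -> subring_of T}, bijective f.

Definition proper_subring (R : comNzRingType) (S : subringClosed R) : Prop :=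
  exists x : R, x \notin S.

Definition maximal_subring (R : comNzRingType) (S : subringClosed R) : Prop :=
  proper_subring S /\
  forall T : subringClosed R,
    proper_subring T -> {subset S <= T} -> {subset T <= S}.

Definition maximal_subring_class (R : comNzRingType) (S : subringClosed R) :
    set (subringClosed R) :=
  [set T | maximal_subring T /\ subring_iso S T].

Definition maximal_subring_classes (R : comNzRingType) :
    set (set (subringClosed R)) :=
  [set maximal_subring_class S | S in [set S | maximal_subring S]].

(* Main.v *)
(* If n is the characteristic of R/J(R), then 1 + nx is a unit for every x, so
   every prime p not dividing n is invertible in R.  Suppose that S_p is a
   subring with 1/p \notin S_p and S_p[1/p] = R.  By Zorn, S_p may be taken
   maximal among the subrings that miss 1/p; it is then a maximal subring.  It
   contains 1/q for every other such prime q, since q is coprime to the powers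
   of p, so the S_p are pairwise non-isomorphic.

   To find S_p, map R to a field K of characteristic 0 (the fraction field of
   R/P, with P an ideal maximal among those avoiding the nonzero integers) and
   pull back a subring V of K with 1/p \notin V and V[1/p] = K, in effect a
   valuation ring of rank one above p.  Such a V is obtained by Zorn among the
   subrings S with 1/p \notin S for which S[1/p] is a field, starting from the
   localization of the integers at p.  A maximal S is integrally closed in K,
   since its integral closure is again of this kind, so every
   element of K algebraic over S[1/p] lies in S[1/p]; and a transcendental
   element is excluded because S is a valuation ring of S[1/p] and thus has a
   Gauss extension. *)

Require Import Defs.
From HB Require Import structures.
From mathcomp Require Import all_boot all_algebra ring_quotient.
From mathcomp Require Import boolp classical_sets functions cardinality.

Set Implicit Arguments.
Unset Strict Implicit.
Unset Printing Implicit Defensive.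
Import GRing.Theory.

Local Open Scope ring_scope.
Local Open Scope quotient_scope.
Local Open Scope classical_set_scope.

(** * Zorn's lemma for subrings and ideals, ordered by their sets of elements *)

Lemma Zorn_above (T X : Type) (m : T -> set X) (Q : set T) (t0 : T) : Q t0 ->
  (forall F : set T, F !=set0 -> F `<=` Q ->
     total_on F (fun s t => m s `<=` m t) ->
     exists2 u, Q u & m u = \bigcup_(s in F) m s) ->
  exists t, [/\ Q t, m t0 `<=` m t &
    forall u, Q u -> m t `<=` m u -> m u `<=` m t].
Proof.
move=> Qt0 QU; pose D := {t | Q t /\ m t0 `<=` m t}.
pose d0 : D := exist _ t0 (conj Qt0 (@subset_refl _ (m t0))).
pose le (s t : D) := `[< m (sval s) `<=` m (sval t) >].
case: (@ZL_preorder _ d0 le).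
- by move=> s; apply/asboolP.
- move=> r s t /asboolP sr /asboolP rt; apply/asboolP.
  exact: subset_trans rt.
- move=> F totF; have [[s0 Fs0]|F0] := pselect (F !=set0); last first.
    by exists d0 => s Fs; case: F0; exists s.
  have [|_ [s _ <-]||u Qu mu] := QU (sval @` F).
  + by exists (sval s0), s0.
  + by have [] := svalP s.
  + move=> _ _ [s Fs <-] [t Ft <-].
    by have [/asboolP|/asboolP] := totF _ _ Fs Ft; [left|right].
  have le_u s : F s -> m (sval s) `<=` m u.
    by move=> Fs x sx; rewrite mu; exists (sval s) => //; exists s.
  have u0 : m t0 `<=` m u.
    by apply: subset_trans (le_u _ Fs0); have [] := svalP s0.
  by exists (exist _ u (conj Qu u0)) => s /le_u su; apply/asboolP.
move=> [t [Qt t0t]] tmax; exists t; split=> // u Qu tu.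
apply/asboolP.
apply: (tmax (exist _ u (conj Qu (subset_trans t0t tu)))); exact/asboolP.
Qed.

Definition subring_mk (R : comNzRingType) (A : {pred R})
    (hA : GRing.subring_closed A) : subringClosed R :=
  HB.pack_for (subringClosed R) (A : R -> bool)
    (GRing.isSubringClosed.Build R A hA).

Lemma subring_union (R : comNzRingType) (F : set (subringClosed R)) :
  F !=set0 ->
  total_on F (fun S T => {subset S <= T}) ->
  exists U : subringClosed R, forall x, x \in U <-> exists2 S, F S & x \in S.
Proof.
move=> [S0 FS0] totF.
pose U : {pred R} := fun x => `[< exists2 S, F S & x \in (S : subringClosed R) >].
have UP x y : x \in U -> y \in U -> exists S, [/\ F S, x \in S & y \in S].
  move=> /asboolP[S FS xS] /asboolP[T FT yT].
  have [ST|TS] := totF _ _ FS FT.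
  - by exists T; split=> //; apply: ST.
  - by exists S; split=> //; apply: TS.
have U_closed : GRing.subring_closed U.
  split=> [|x y xU yU|x y xU yU].
  - by apply/asboolP; exists S0 => //; rewrite rpred1.
  - have [S [FS xS yS]] := UP _ _ xU yU.
    by apply/asboolP; exists S => //; rewrite rpredB.
  - have [S [FS xS yS]] := UP _ _ xU yU.
    by apply/asboolP; exists S => //; rewrite rpredM.
by exists (subring_mk U_closed) => x; split=> [/asboolP|?] //; apply/asboolP.
Qed.

(** Chains serve only to make the union a subring, so [Q] is asked to be stable under every nonempty
    union that is a subring. *)
Lemma subring_Zorn (R : comNzRingType) (Q : set (subringClosed R)) S0 : Q S0 ->
  (forall (F : set (subringClosed R)) (U : subringClosed R),
     F !=set0 -> F `<=` Q -> (forall x, x \in U <-> exists2 S, F S & x \in S) ->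
     Q U) ->
  exists S, [/\ Q S, {subset S0 <= S} &
    forall T, Q T -> {subset S <= T} -> {subset T <= S}].
Proof.
move=> QS0 QU; pose m (S : subringClosed R) : set R := fun x => x \in S.
have [F F0 FQ|S [QS S0S Smax]] := @Zorn_above _ R m Q S0 QS0; last by exists S.
move=> /(subring_union F0)[U UP]; exists U; first exact: QU UP.
by apply/seteqP; split=> x /UP.
Qed.

(** Used with [W] the positive integers, where it yields a prime ideal, and with [W] equal to
    $\{1\}$, where it yields a maximal ideal. *)
Lemma ideal_Zorn (R : comNzRingType) (W : set R) (I : idealr R) :
  (forall x, x \in I -> ~ W x) ->
  exists M : idealr R, [/\ forall x, x \in M -> ~ W x, {subset I <= M} &
    forall N : idealr R, (forall x, x \in N -> ~ W x) ->
      {subset M <= N} -> {subset N <= M}].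
Proof.
move=> IW; pose m (J : idealr R) : set R := fun x => x \in J.
have [F [I0 FI0] FW totF|M [MW IM Mmax]] :=
  @Zorn_above _ R m [set J | forall x, x \in J -> ~ W x] I IW; last by exists M.
pose U : {pred R} := fun x => `[< exists2 I, F I & x \in (I : idealr R) >].
have U_closed : idealr_closed U.
  split=> [||a u v].
  - by apply/asboolP; exists I0; rewrite ?rpred0.
  - by apply/negP => /asboolP[J _]; rewrite idealr1.
  move=> /asboolP[J FJ uJ] /asboolP[J' FJ' vJ']; apply/asboolP.
  have [JJ'|J'J] := totF _ _ FJ FJ'.
  - by exists J' => //; rewrite rpredD ?idealMr //; apply: JJ'.
  - by exists J => //; rewrite rpredD ?idealMr //; apply: J'J.
exists (ideal_mk U_closed) => [x /asboolP[J /FW] | ]; first exact.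
apply/seteqP; split=> x; first by move=> /asboolP.
by move=> Ux; apply/asboolP.
Qed.

(** * Integral closure of the subrings that become a field when [a] is inverted *)

Section FieldAfterInverting.
Variables (K : fieldType) (a : K).

(* S[1/a] is a field that is larger than S. *)
Definition field_after_inverting : set (subringClosed K) := [set S |
  [/\ a \in S, a^-1 \notin S &
    forall x, x \in S -> x != 0 -> exists k, a ^+ k / x \in S]].

Lemma integralOver_subring (S : subringClosed K) x :
  integralOver (\val : subring_of S -> K) x <->
  exists q, [/\ q \is monic, q \is a polyOver S & root q x].
Proof.
split=> [[p p_monic px0]|[q [q_monic /polyOverP qS qx0]]].
  exists (map_poly \val p); split=> //; first exact: monic_map.
  by apply/polyOverP => i; rewrite coef_map; apply: valP.
(* [insubd] sends everything outside [S] to the default 0; as it fixes 0, it can be applied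
   coefficientwise. *)
have i0 : insubd (0 : subring_of S) 0 = 0.
  by apply: val_inj; rewrite insubdK ?rpred0 // raddf0.
have qE : map_poly \val (map_poly (insubd (0 : subring_of S)) q) = q.
  by apply/polyP => i; rewrite coef_map coef_map_id0 //; apply: insubdK.
exists (map_poly (insubd (0 : subring_of S)) q); last by rewrite qE.
apply/eqP; apply: val_inj; rewrite rmorph1 -(monicP q_monic) -[in RHS]qE.
by rewrite -[LHS]lead_coef_map_inj //; exact: val_inj.
Qed.

(** Multiplying a monic equation of degree $n+1$ for $1/x$ by $x^n$ leaves $1/x$ plus terms in
    [S]. *)
Lemma integral_inv_mem (S : subringClosed K) x :
  x \in S -> integralOver (\val : subring_of S -> K) x^-1 -> x^-1 \in S.
Proof.
move=> xS /integralOver_subring[q [q_monic /polyOverP qS /rootP qx0]].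
have [->|x0] := eqVneq x 0; first by rewrite invr0 rpred0.
have q_gt0 : (0 < size q)%N by rewrite size_poly_gt0 monic_neq0.
move: qx0 (monicP q_monic); rewrite horner_coef /lead_coef -(prednK q_gt0).
case: (size q).-1 => [|n]; rewrite big_ord_recr /= => /[swap] ->; rewrite mul1r.
    by rewrite big_ord0 add0r expr0 => /eqP; rewrite oner_eq0.
move=> /(congr1 (fun z => z * x ^+ n)); rewrite mul0r mulrDl exprS -mulrA exprVn.
rewrite mulVf ?expf_neq0 // mulr1 addrC => /eqP; rewrite addr_eq0 => /eqP->.
rewrite rpredN mulr_suml rpred_sum // => i _.
rewrite -mulrA rpredM ?qS //.
have le_in : (i <= n)%N by rewrite -ltnS.
rewrite -[in x ^+ n](subnK le_in) exprD exprVn mulrCA mulVf ?expf_neq0 // mulr1.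
exact: rpredX.
Qed.

Lemma polyOverMXaddC (S : subringClosed K) q c :
  q * 'X + c%:P \is a polyOver S -> c \in S /\ q \is a polyOver S.
Proof.
move/polyOverP => qS; split.
  by have := qS 0; rewrite coefD coefMX coefC add0r.
by apply/polyOverP => i; have := qS i.+1; rewrite coefD coefMX coefC addr0.
Qed.

(* [r * 'X + c] is q with its factors ['X] removed. *)
Lemma root_nonzero_const (S : subringClosed K) q y :
  q \is a polyOver S -> q != 0 -> root q y -> y != 0 ->
  exists r c, [/\ r \is a polyOver S, c \in S, c != 0 & r.[y] * y + c = 0].
Proof.
move=> + + + y0; elim/poly_ind: q => [|q c IH] qS; first by rewrite eqxx.
have [cS qS'] := polyOverMXaddC qS.
rewrite /root hornerMXaddC; have [->|c0] := eqVneq c 0; last first.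
  by move=> _ /eqP; exists q, c.
rewrite polyC0 !addr0 => q0; rewrite mulf_eq0 (negPf y0) orbF => qy0.
apply: IH => //.
by apply: contraNneq q0 => ->; rewrite mul0r.
Qed.

Lemma integral_closure_closed (S : subringClosed K) :
  GRing.subring_closed
    (fun x => `[< integralOver (\val : subring_of S -> K) x >]).
Proof.
split=> [|x y /asboolP xI /asboolP yI|x y /asboolP xI /asboolP yI]; apply/asboolP.
- exact: integral1.
- exact: integral_sub.
- exact: integral_mul.
Qed.

Lemma mem_integral (S : subringClosed K) x :
  x \in S -> integralOver (\val : subring_of S -> K) x.
Proof.
by move=> xS; rewrite -[x]/(\val (SubringOf xS)); apply: integral_id.
Qed.

(* A nonzero y integral over S satisfies r(y) y + c = 0 with c nonzero in S, so
   a^k / y = - (a^k / c) r(y). *)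
Lemma integral_closure_good (S : subringClosed K) :
  field_after_inverting S ->
  field_after_inverting (subring_mk (integral_closure_closed S)).
Proof.
move=> [aS aVS fS]; split=> [||y /asboolP yI y0].
- exact/asboolP/mem_integral.
- by apply: contra aVS => /asboolP; apply: integral_inv_mem.
have /integralOver_subring[q [q_monic qS qy]] := yI.
have [r [c [/polyOverP rS cS c0]]] :=
  root_nonzero_const qS (monic_neq0 q_monic) qy y0.
move=> /eqP; rewrite addr_eq0 => /eqP ryE.
have [k kS] := fS c cS c0; exists k; apply/asboolP.
have -> : a ^+ k / y = - (a ^+ k / c * r.[y]).
  apply: (mulIf y0); rewrite mulfVK // mulNr -(mulrA _ _ y) ryE mulrN opprK.
  by rewrite mulfVK.
apply: integral_opp; apply: integral_mul; first exact: mem_integral.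
by apply: integral_horner => //; apply/integral_poly => i; apply: mem_integral.
Qed.

(** * Maximal such subrings are valuation rings *)

Section Maximal.
Variable S : subringClosed K.
Hypothesis S_good : field_after_inverting S.
Hypothesis S_max : forall T : subringClosed K,
  field_after_inverting T -> {subset S <= T} -> {subset T <= S}.

Let aS : a \in S. Proof. by case: S_good. Qed.
Let aVS : a^-1 \notin S. Proof. by case: S_good. Qed.
Let a0 : a != 0. Proof. by apply: contra aVS => /eqP->; rewrite invr0 rpred0. Qed.
Let fS x : x \in S -> x != 0 -> exists k, a ^+ k / x \in S.
Proof. by case: S_good => _ _; apply. Qed.

Lemma maximal_integrally_closed q x :
  q \is monic -> q \is a polyOver S -> root q x -> x \in S.
Proof.
move=> q_monic qS qx.
apply: (S_max (integral_closure_good S_good)) => [y yS|]; apply/asboolP.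
- exact: mem_integral.
- by apply/integralOver_subring; exists q.
Qed.

Lemma localization_closed :
  GRing.subring_closed (fun x : K => `[< exists k, a ^+ k * x \in S >]).
Proof.
split=> [|x y /asboolP[k kx] /asboolP[l ly]|x y /asboolP[k kx] /asboolP[l ly]].
- by apply/asboolP; exists 0; rewrite mulr1 rpred1.
- apply/asboolP; exists (k + l); rewrite mulrBr rpredB //.
  + by rewrite exprD mulrAC rpredM ?rpredX.
  + by rewrite exprD -mulrA rpredM ?rpredX.
- apply/asboolP; exists (k + l); by rewrite exprD mulrACA rpredM.
Qed.

(** This is $S[1/a]$, which by [fS] is the fraction field of [S]. *)
Definition localization := subring_mk localization_closed.
Lemma localizationP x : reflect (exists k, a ^+ k * x \in S) (x \in localization).
Proof. exact: asboolP. Qed.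

(** For nonzero $x \in T$ choose $k, l$ with $s = a^k x \in S$ and $a^l/s \in S$. Then $a^l/x = a^k
    (a^l/s)$ lies in [T], so [S_max] applies to [T]. *)
Lemma maximal_in_localization (T : subringClosed K) :
  {subset S <= T} -> {subset T <= localization} -> a^-1 \notin T ->
  {subset T <= S}.
Proof.
move=> ST TL aVT; apply: S_max => //; split=> // [|x xT x0]; first exact: ST.
have /localizationP[k kx] := TL x xT.
have [|l lS] := fS kx; first by rewrite mulf_neq0 ?expf_neq0.
exists l; rewrite -[_ / _](mulfVK (expf_neq0 k a0)) rpredM ?rpredX ?ST //.
by rewrite -mulrA -invfM [x * _]mulrC.
Qed.

Lemma adjoin_closed (y : K) : GRing.subring_closed
  (fun z => `[< exists2 q, q \is a polyOver S & z = q.[y] >]).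
Proof.
split=> [|_ _ /asboolP[p pS ->] /asboolP[q qS ->]|
          _ _ /asboolP[p pS ->] /asboolP[q qS ->]]; apply/asboolP.
- by exists 1; rewrite ?hornerC ?rpred1.
- by exists (p - q); rewrite ?hornerE ?rpredB.
- by exists (p * q); rewrite ?hornerE ?rpredM.
Qed.

(** The ring $S[x/y]$ lies in $S[1/a]$ because $1/y$ does, so by maximality it is contained in [S]
    unless it contains $1/a$. *)
Lemma maximal_adjoin x y : x \in S -> y \in S -> y != 0 ->
  x / y \in S \/ exists2 q, q \is a polyOver S & a^-1 = q.[x / y].
Proof.
move=> xS yS y0; pose T := subring_mk (adjoin_closed (x / y)).
have [|NaV] := pselect (a^-1 \in T); first by move=> /asboolP; right.
left; apply: (@maximal_in_localization T).
- by move=> z zS; apply/asboolP; exists z%:P; rewrite ?polyOverC ?hornerC.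
- move=> _ /asboolP[q /polyOverP qS ->]; rewrite rpred_horner //.
    apply/polyOverP => i; apply/localizationP; exists 0; by rewrite mul1r.
  apply/localizationP; have [k kS] := fS yS y0; exists k.
  by rewrite mulrCA mulrC rpredM // mulrC.
- exact/negP.
- by apply/asboolP; exists 'X; rewrite ?polyOverX ?hornerX.
Qed.

Lemma clear_denominators q y : q \is a polyOver S -> y \in S -> y != 0 ->
  exists n, y ^+ n * q.[y^-1] \in S.
Proof.
move=> + yS y0; elim/poly_ind: q => [|q c IH] qS.
  by exists 0; rewrite horner0 mulr0 rpred0.
have [cS qS'] := polyOverMXaddC qS.
have [n nS] := IH qS'; exists n.+1; rewrite hornerMXaddC mulrDr rpredD //.
  by rewrite exprSr mulrACA mulfV // mulr1.
by rewrite rpredM ?rpredX.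
Qed.

(* If u = 1 - a s were not invertible, then 1/a would lie in S[1/u]; but u^n is
   congruent to 1 modulo a, so clearing denominators puts 1/a in S. *)
Lemma maximal_unit s : s \in S -> (1 - a * s)^-1 \in S.
Proof.
move=> sS; set u := 1 - a * s.
have uS : u \in S by rewrite rpredB ?rpred1 ?rpredM.
have u0 : u != 0.
  apply: contra aVS; rewrite subr_eq0 => /eqP as1.
  by rewrite -[a^-1]mulr1 as1 mulKf.
have [|[q qS aVq]] := maximal_adjoin (rpred1 _) uS u0; first by rewrite div1r.
have [n] := clear_denominators qS uS u0; rewrite -[_^-1]div1r -aVq => nS.
have [t tS ut] : exists2 t, t \in S & u ^+ n = 1 - a * t.
  elim: n {nS} => [|n [t tS ut]]; first by exists 0; rewrite ?rpred0 ?mulr0 ?subr0.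
  exists (t + s * u ^+ n); first by rewrite rpredD ?rpredM ?rpredX.
  by rewrite exprS {1}/u mulrBl mul1r {1}ut mulrDr opprD addrA mulrA.
case/negP: aVS; rewrite -[a^-1]mul1r -[1](subrK (a * t)) -ut mulrDl.
by rewrite rpredD // mulrAC mulfV // mul1r.
Qed.

(** This reverses [q] with the term of $q_0$ split off; the bound on [size r] lets $x^n$ become the
    leading term of a monic equation. *)
Lemma reverse_horner q x : q \is a polyOver S -> x != 0 ->
  exists n r, [/\ r \is a polyOver S, (size r <= n)%N &
    q.[x^-1] * x ^+ n = q`_0 * x ^+ n + r.[x]].
Proof.
move=> + x0; elim/poly_ind: q => [|q c IH] qS.
  by exists 0, 0; rewrite !horner0 coef0 !mul0r add0r size_poly0 polyOver0.
have [cS qS'] := polyOverMXaddC qS.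
have [n [r [rS r_le rE]]] := IH qS'; exists n.+1, (q`_0 *: 'X^n + r); split.
- by rewrite rpredD ?polyOverZ ?polyOverXn //; apply/polyOverP.
- rewrite (leq_trans (size_polyD _ _)) // geq_max (leqW r_le) andbT.
  by rewrite (leq_trans (size_scale_leq _ _)) ?size_polyXn.
- rewrite hornerMXaddC coefD coefMX coefC /= add0r mulrDl addrC; congr (_ + _).
  by rewrite !hornerE -rE exprS mulrA mulfVK.
Qed.

(* If y/x is not in S, then 1/a = q(y/x) with q over S; multiplying by a power
   of x/y gives an integral equation for x/y, as 1 - a q(0) is a unit. *)
Lemma maximal_valuation x y : x \in S -> y \in S -> x != 0 -> y != 0 ->
  x / y \in S \/ y / x \in S.
Proof.
move=> xS yS x0 y0.
have [|[q qS aVq]] := maximal_adjoin yS xS x0; first by right.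
left; set z := x / y; have z0 : z != 0 by rewrite mulf_neq0 ?invr_eq0.
have [n [r [rS r_le]]] := reverse_horner qS z0.
rewrite [z^-1]invf_div -aVq => rE.
have q0S : q`_0 \in S by move/polyOverP: qS.
have u0 : 1 - a * q`_0 != 0.
  apply: contra aVS; rewrite subr_eq0 => /eqP as1.
  by rewrite -[a^-1]mulr1 as1 mulKf.
(* Multiplied by $ua$, the relation $a^{-1} z^n = q_0 z^n + r(z)$ becomes $z^n - u a r(z) = 0$. *)
pose u := (1 - a * q`_0)^-1.
have cS : - (u * a) \in S by rewrite rpredN rpredM ?maximal_unit.
have r'_le : (size (- (u * a) *: r) < size ('X^n : {poly K}))%N.
  by rewrite size_polyXn ltnS (leq_trans (size_scale_leq _ _)).
apply: (@maximal_integrally_closed ('X^n + - (u * a) *: r)).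
- by rewrite monicE lead_coefDl // lead_coefXn.
- by rewrite rpredD ?polyOverXn ?polyOverZ.
- rewrite /root !hornerE; apply/eqP.
  have -> : r.[z] = a^-1 * z ^+ n - q`_0 * z ^+ n by rewrite rE addrC addKr.
  rewrite -mulrBl mulrA mulNr -mulrA mulrBr mulfV // mulVf // mulNr mul1r.
  exact: subrr.
Qed.

(** * Primitive polynomials over the valuation ring [S] *)

(** This is the maximal ideal of [S]. Zero has its own clause because $0^{-1} = 0$ lies in [S]. *)
Definition nonunit : pred K :=
  fun b => (b \in S) && ((b == 0) || (b^-1 \notin S)).

Definition primitive (q : {poly K}) :=
  q \is a polyOver S /\ exists i, ~~ nonunit q`_i.

Lemma nonunit_mul b c : nonunit b -> c \in S -> nonunit (b * c).
Proof.
move=> /andP[bS b_nu] cS; rewrite /nonunit rpredM //=.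
have [->|b0] := eqVneq b 0; first by rewrite mul0r eqxx.
have [->|c0] := eqVneq c 0; first by rewrite mulr0 eqxx.
rewrite (negPf b0) in b_nu; rewrite mulf_eq0 (negPf b0) (negPf c0) /=.
apply: contra b_nu => bcV.
by rewrite -[b^-1](mulVKf c0) -invfM [c * b]mulrC rpredM.
Qed.

Lemma nonunitN b : nonunit (- b) = nonunit b.
Proof. by rewrite /nonunit invrN !rpredN oppr_eq0. Qed.

(** One of $b/c$ and $c/b$ lies in [S], so the sum is a multiple of [c] or of [b]. *)
Lemma nonunitD b c : nonunit b -> nonunit c -> nonunit (b + c).
Proof.
move=> b_nu c_nu; have [/andP[bS _] /andP[cS _]] := (b_nu, c_nu).
have [->|b0] := eqVneq b 0; first by rewrite add0r.
have [->|c0] := eqVneq c 0; first by rewrite addr0.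
have [bc|cb] := maximal_valuation bS cS b0 c0.
  rewrite -[b](mulfVK c0) -[X in _ + X]mul1r -mulrDl mulrC.
  by rewrite nonunit_mul // rpredD ?rpred1.
rewrite -[c](mulfVK b0) -[X in X + _]mul1r -mulrDl mulrC.
by rewrite nonunit_mul // rpredD ?rpred1.
Qed.

Lemma nonunit0 : nonunit 0. Proof. by rewrite /nonunit rpred0 eqxx. Qed.

Lemma primitive1 : primitive 1.
Proof.
split; first by rewrite rpred1.
by exists 0; rewrite coefC /nonunit oner_eq0 invr1 rpred1.
Qed.

Lemma nonunit_prime b c : b \in S -> c \in S -> nonunit (b * c) ->
  nonunit b || nonunit c.
Proof.
move=> bS cS; rewrite /nonunit bS cS rpredM //= mulf_eq0.
have [//|b0] := eqVneq b 0; have [|c0 /=] := eqVneq c 0; first by rewrite !orbT.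
move=> /= bcV; rewrite -negb_and; apply: contra bcV => /andP[bV cV].
by rewrite invfM rpredM.
Qed.

(** Gauss's lemma: if $p_i$ and $q_j$ are the first unit coefficients, every other term in the
    coefficient of degree $i+j$ has a nonunit factor. *)
Lemma primitive_mul p q : primitive p -> primitive q -> primitive (p * q).
Proof.
move=> [pS ex_i] [qS ex_j]; split; first by rewrite rpredM.
case: (@ex_minnP (fun i => ~~ nonunit p`_i) ex_i) => i pi i_min.
case: (@ex_minnP (fun j => ~~ nonunit q`_j) ex_j) => j qj j_min.
move: (pS) (qS) => /polyOverP pS' /polyOverP qS'.
exists (i + j); apply/negP => pq_nu.
suff /(nonunit_prime (pS' i) (qS' j)) : nonunit (p`_i * q`_j).
  by rewrite (negPf pi) (negPf qj).
have lt_i : (i < (i + j).+1)%N by rewrite ltnS leq_addr.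
rewrite coefM (bigD1 (Ordinal lt_i)) //= addKn in pq_nu.
set s := \sum_(_ < _ | _) _ in pq_nu.
have s_nu : nonunit s.
  apply: (big_ind (fun b => nonunit b)) => [|b c|k k_i].
  - exact: nonunit0.
  - exact: nonunitD.
  have [k_lt|k_ge|k_eq] := ltngtP k i.
  - apply: nonunit_mul => //; apply: contraTT k_lt => pk.
    by rewrite -leqNgt i_min.
  - rewrite mulrC; apply: nonunit_mul => //; apply: contraTT k_ge => qk.
    have k_le : (k <= i + j)%N by rewrite -ltnS.
    by have := j_min _ qk; rewrite leq_subRL // leq_add2r -leqNgt.
  - by case/eqP: k_i; apply: val_inj.
by rewrite -[_ * _](addrK s) nonunitD ?nonunitN.
Qed.

(** Induction on the content: in $d w X + c$ with [w] primitive and $c \neq 0$, one of $c/d$ and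
    $d/c$ lies in [S], and whichever of [c] and [d] divides the other is the new content. *)
Lemma primitive_part q : q \is a polyOver S -> q != 0 ->
  exists c w, [/\ c \in S, c != 0, primitive w & q = c *: w].
Proof.
elim/poly_ind: q => [|q c IH] qS; first by rewrite eqxx.
have [cS qS'] := polyOverMXaddC qS; have nu1 : ~~ nonunit 1.
  by rewrite /nonunit oner_eq0 invr1 rpred1.
have [->|q0] := eqVneq q 0.
  rewrite mul0r add0r polyC_eq0 => c0; exists c, 1; rewrite alg_polyC; split=> //.
  by split; [rewrite rpred1 | exists 0; rewrite coefC].
move=> _; have [d [w [dS d0 [wS [i wi]] ->]]] := IH qS' q0.
have prim e : e \in S -> primitive (w * 'X + e%:P).
  move=> eS; split; first by rewrite rpredD ?rpredM ?polyOverX ?polyOverC.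
  by exists i.+1; rewrite coefD coefMX coefC addr0.
have [->|c0] := eqVneq c 0.
  exists d, (w * 'X + 0%:P); split=> //; first exact/prim/rpred0.
  by rewrite !addr0 scalerAl.
have [cd|dc] := maximal_valuation cS dS c0 d0.
  exists d, (w * 'X + (c / d)%:P); split=> //; first exact: prim.
  by rewrite scalerDr scalerAl -[_ *: _%:P]mul_polyC -polyCM [d * _]mulrC divfK.
exists c, ((d / c) *: w * 'X + 1); split=> //.
  split; first by rewrite rpredD ?rpredM ?polyOverZ ?polyOverX ?rpred1.
  by exists 0; rewrite coefD coefMX add0r coefC.
by rewrite scalerDr alg_polyC scalerAl scalerA [c * _]mulrC divfK.
Qed.

(** * The Gauss extension excludes transcendental elements *)

Section Transcendental.
Variable x : K.
Hypothesis x_tr : forall q, q \is a polyOver S -> q != 0 -> q.[x] != 0.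

Lemma primitive_horner q : primitive q -> q.[x] != 0.
Proof.
move=> [qS [i qi]]; apply: x_tr => //; apply: contra qi => /eqP->.
by rewrite coef0 nonunit0.
Qed.

(* The evaluation at x of the localization of S[X] at the primitive polynomials:
   the Gauss extension of the valuation ring S. *)
Lemma gauss_closed : GRing.subring_closed (fun z => `[< exists p q,
  [/\ p \is a polyOver S, primitive q & z * q.[x] = p.[x]] >]).
Proof.
split=> [|z1 z2 /asboolP[p1 [q1 [p1S q1P E1]]] /asboolP[p2 [q2 [p2S q2P E2]]]|
  z1 z2 /asboolP[p1 [q1 [p1S q1P E1]]] /asboolP[p2 [q2 [p2S q2P E2]]]].
- apply/asboolP; exists 1, 1; rewrite mul1r rpred1; split=> //.
  exact: primitive1.
- apply/asboolP; exists (p1 * q2 - p2 * q1), (q1 * q2); split.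
  + by rewrite rpredB ?rpredM //; [case: q2P|case: q1P].
  + exact: primitive_mul.
  + rewrite hornerD hornerN !hornerM -E1 -E2 mulrBl mulrA; congr (_ - _).
    by rewrite [q1.[x] * _]mulrC mulrA.
- apply/asboolP; exists (p1 * p2), (q1 * q2); split; first by rewrite rpredM.
  + exact: primitive_mul.
  + by rewrite !hornerM -E1 -E2 mulrACA.
Qed.

(** If $1/a = p(x)/q(x)$, then $q = a p$ by transcendence, and this is not primitive. For $z =
    p(x)/q(x)$ write $p = c w$ with [w] primitive; then $a^k/z = (a^k/c) q(x)/w(x)$, where $a^k/c
    \in S$ for some $k$. *)
Lemma gauss_good : field_after_inverting (subring_mk gauss_closed).
Proof.
split=> [||z /asboolP[p [q [pS qP zE]]] z0].
- apply/asboolP; exists a%:P, 1; rewrite polyOverC !hornerE; split=> //.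
  exact: primitive1.
- apply/asboolP => -[p [q [pS [qS [i qi]] E]]].
  have qE : q = a *: p.
    apply/eqP; rewrite -subr_eq0; apply: contraT => /x_tr/negP[].
      by rewrite rpredB ?polyOverZ.
    by rewrite !hornerE -E mulrA mulfV // mul1r subrr.
  case/negP: qi; rewrite qE coefZ; apply: nonunit_mul; last exact/polyOverP.
  by rewrite /nonunit aS aVS orbT.
- have p0 : p != 0.
    apply: contraNneq z0 => p0; move/eqP: zE; rewrite p0 horner0 mulf_eq0.
    by rewrite (negPf (primitive_horner qP)) orbF.
  have [c [w [cS c0 wP pE]]] := primitive_part pS p0.
  have [k kS] := fS cS c0; exists k; apply/asboolP.
  exists ((a ^+ k / c) *: q), w; split=> //; first by rewrite polyOverZ //; case: qP.
  apply: (mulfI z0); rewrite hornerZ [LHS]mulrA [z * _]mulrCA mulfV // mulr1.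
  rewrite mulrCA zE pE hornerZ mulrA mulfVK //.
Qed.

(** Maximality against the Gauss extension puts [x] in [S], and then $X - x$ is a polynomial over
    [S] vanishing at [x]. *)
Lemma maximal_not_transcendental : False.
Proof.
have xS : x \in S.
  apply: (S_max gauss_good) => [y yS|]; apply/asboolP.
    by exists y%:P, 1; rewrite polyOverC !hornerE; split=> //; apply: primitive1.
  by exists 'X, 1; rewrite polyOverX !hornerE; split=> //; apply: primitive1.
have /negP[] := x_tr (etrans (polyOverXsubC _ _) xS) (negbT (polyXsubC_eq0 x)).
by rewrite !hornerE subrr.
Qed.
End Transcendental.

(** If [x] is a root of [q] with leading coefficient $l$, then $l x$ is integral over [S], hence in
    [S], and some $a^k/l$ lies in [S]. *)
Lemma maximal_localization x : exists k, a ^+ k * x \in S.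
Proof.
have [[q [qS q0 qx]]|x_tr] := pselect (exists q,
    [/\ q \is a polyOver S, q != 0 & q.[x] = 0]); last first.
  exfalso; apply: (@maximal_not_transcendental x) => q qS q0.
  by apply/eqP => qx; apply: x_tr; exists q.
have lq0 : lead_coef q != 0 by rewrite lead_coef_eq0.
have lqS : lead_coef q \in S by apply/(polyOverP qS).
suff lxS : lead_coef q * x \in S.
  have [k kS] := fS lqS lq0; exists k.
  by rewrite -[a ^+ k](divfK lq0) -(mulrA _ _ x) rpredM.
move/polyOverP: qS => qS; set l := lead_coef q in lq0 lqS *.
have q_gt1 : (1 < size q)%N.
  rewrite ltnNge; apply: contra lq0 => /size1_polyC qC.
  by rewrite /l qC lead_coefC -(hornerC q`_0 x) -qC qx.
move: qx; rewrite horner_coef -(prednK (ltnW q_gt1)) big_ord_recr /= -/l.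
have -> : q`_(size q).-1 = l by [].
have n_gt0 : (0 < (size q).-1)%N by rewrite -ltnS prednK // ltnW.
move: n_gt0; case: (size q).-1 => // n _ sum0.
(* As [q] has degree $n+1$, the relation $l^n q(x) = 0$ is a monic equation for $l x$. *)
pose r := \poly_(i < n.+1) (q`_i * l ^+ (n - i)).
apply: (@maximal_integrally_closed ('X^(n.+1) + r)).
- by rewrite monicE lead_coefDl ?lead_coefXn // size_polyXn ltnS size_poly.
- rewrite rpredD ?polyOverXn //; apply/polyOverP => i.
  by rewrite coef_poly; case: ifP => _; rewrite ?rpred0 ?rpredM ?rpredX.
rewrite /root hornerD hornerXn horner_poly; apply/eqP.
rewrite -[RHS](mulr0 (l ^+ n)) -[in RHS]sum0 mulrDr mulr_sumr.
rewrite addrC [l ^+ n * (l * _)]mulrA -exprSr -exprMn; congr (_ + _).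
apply: eq_bigr => i _; rewrite exprMn [RHS]mulrCA -mulrA; congr (_ * _).
by rewrite mulrA -exprD subnK // -ltnS.
Qed.
End Maximal.
End FieldAfterInverting.

(** * The localization of the integers at [p], and its enlargement by Zorn *)

Lemma integers_prime_to_closed (K : fieldType) (p : nat) : prime p ->
  GRing.subring_closed (fun z : K => `[< exists (m : int) (n : nat),
    ~~ (p %| n)%N /\ z * n%:R = m%:~R >]).
Proof.
move=> p_pr; split=> [|z1 z2 /asboolP[m1 [n1 [pn1 E1]]] /asboolP[m2 [n2 [pn2 E2]]]|
  z1 z2 /asboolP[m1 [n1 [pn1 E1]]] /asboolP[m2 [n2 [pn2 E2]]]]; apply/asboolP.
- by exists 1, 1%N; rewrite dvdn1 mul1r neq_ltn prime_gt1 // orbT.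
- exists (m1 * n2%:Z - m2 * n1%:Z), (n1 * n2)%N; rewrite Euclid_dvdM // negb_or pn1 pn2.
  split=> //; rewrite rmorphB !rmorphM /= -E1 -E2 -!pmulrn.
  by rewrite mulrBl !mulrA [z2 * _ * n2%:R]mulrAC.
- exists (m1 * m2), (n1 * n2)%N; rewrite Euclid_dvdM // negb_or pn1 pn2; split=> //.
  by rewrite !rmorphM /= -E1 -E2 mulrACA.
Qed.

Lemma integers_prime_to_good (K : fieldType) (p : nat) (p_pr : prime p) :
  (forall n, n.+1%:R != 0 :> K) ->
  field_after_inverting p%:R (subring_mk (integers_prime_to_closed K p_pr)).
Proof.
move=> K0.
have int0 (m : int) : m%:~R = 0 :> K -> m = 0.
  case: m => [[|n]|n] //; first by move/eqP; rewrite -pmulrn (negPf (K0 n)).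
  by rewrite NegzE mulrNz => /eqP; rewrite oppr_eq0 -pmulrn (negPf (K0 n)).
have p0 : p%:R != 0 :> K by rewrite -(prednK (prime_gt0 p_pr)).
split=> [||z /asboolP[m [n [pn E]]] z0].
- by apply/asboolP; exists p, 1%N; rewrite dvdn1 mulr1 neq_ltn prime_gt1 // orbT.
- apply/asboolP => -[m [n [/negP pn E]]]; apply: pn.
  have /int0/eqP : (n%:Z - p%:Z * m)%:~R = 0 :> K.
    by rewrite rmorphB rmorphM /= -E mulVKf // subrr.
  rewrite subr_eq0 => /eqP nE; have : (p %| n%:Z)%Z by rewrite nE dvdz_mulr.
  by [].
have n0 : n%:R != 0 :> K by case: n pn {E} => [|n]; rewrite ?dvdn0.
have m0 : m != 0.
  by apply: contraTneq (mulf_neq0 z0 n0) => m0; rewrite E m0 eqxx.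
have m_gt0 : (0 < `|m|)%N by rewrite absz_gt0.
have [m' pm' mE] := pfactor_coprime p_pr m_gt0.
rewrite prime_coprime // in pm'.
exists (logn p `|m|%N); apply/asboolP.
(* Since $z = m/n$ and $|m| = m' p^k$ for the exponent $k$ just given, $p^k/z = \pm n/m'$. *)
exists ((-1) ^+ (m < 0)%R * n%:Z), m'; split=> //; apply: (mulIf z0).
rewrite mulrAC divfK // -natrX -natrM mulnC -mE rmorphM /= -pmulrn.
rewrite -mulrA [n%:R * _]mulrC E {3}[m]intEsign !rmorphM /= mulrA -pmulrn.
by rewrite !rmorph_sign -expr2 sqrr_sign mul1r.
Qed.

Lemma field_localization (K : fieldType) (a : K) S0 :
  field_after_inverting a S0 ->
  exists S : subringClosed K,
    a^-1 \notin S /\ forall x, exists k, a ^+ k * x \in S.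
Proof.
move=> S0_good.
have [F U [S1 FS1] FQ UP|S [S_good _ S_max]] := subring_Zorn S0_good.
  split=> [||x /UP[S FS xS] x0].
  - by apply/UP; exists S1 => //; have [] := FQ _ FS1.
  - by apply/negP => /UP[S FS]; have [_ /negP] := FQ _ FS.
  - have [_ _ /(_ x xS x0)[k kS]] := FQ _ FS.
    by exists k; apply/UP; exists S.
exists S; split; first by case: S_good.
exact: maximal_localization S_good S_max.
Qed.

(** * Homomorphisms to a field of characteristic 0 *)

(** The ideal is $P + xR$; the hypothesis keeps 1 out of it, as the type [idealr] requires. *)
Lemma ideal_adjoin (R : comNzRingType) (P : idealr R) x :
  (forall b, 1 - x * b \notin P) ->
  exists J : idealr R, [/\ {subset P <= J}, x \in J &
    forall z, z \in J -> exists b, z - x * b \in P].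
Proof.
move=> x_proper.
have J_closed : idealr_closed (fun z => `[< exists b, z - x * b \in P >]).
  split=> [||c u v /asboolP[b bP] /asboolP[b' bP']].
  - by apply/asboolP; exists 0; rewrite mulr0 subr0 rpred0.
  - by apply/negP => /asboolP[b]; rewrite (negPf (x_proper b)).
  apply/asboolP; exists (c * b + b').
  have -> : c * u + v - x * (c * b + b') = c * (u - x * b) + (v - x * b').
    by rewrite mulrDr mulrBr opprD addrACA mulrCA.
  by rewrite rpredD ?idealMr.
exists (ideal_mk J_closed); split=> [z zP||z /asboolP//]; apply/asboolP.
- by exists 0; rewrite mulr0 subr0.
- by exists 1; rewrite mulr1 subrr rpred0.
Qed.

(** Fraction fields are built over an [idomainType], so [D] is first given an inverse operation by
    choice, the identity on non-units. *)
Lemma integral_fraction (D : comNzRingType) :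
  (forall x y : D, x * y = 0 -> (x == 0) || (y == 0)) ->
  exists (K : fieldType) (f : {rmorphism D -> K}), injective f.
Proof.
move=> D_int.
pose unit : pred D := fun x => `[< exists y, y * x = 1 >].
pose inv (x : D) :=
  if pselect (exists y, y * x = 1) is left e then projT1 (cid e) else x.
have mulV : {in unit, left_inverse 1 inv *%R}.
  by move=> x /asboolP ex; rewrite /inv; case: pselect => // e; case: cid.
have unitP x y : y * x = 1 -> unit x by move=> yx; apply/asboolP; exists y.
have invN : {in [predC unit], inv =1 id}.
  move=> x /negP xN; rewrite /inv; case: pselect => // e; case: xN; exact/asboolP.
pose D1 : comUnitRingType := HB.pack (GRing.ComNzRing.sort D)
  (GRing.ComNzRing_hasMulInverse.Build D mulV unitP invN).
pose D2 : idomainType := HB.pack (GRing.ComNzRing.sort D) D1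
  (GRing.ComUnitRing_isIntegral.Build D1 D_int).
exists {fraction D2}, (@FracField.tofrac D2 : {rmorphism D2 -> {fraction D2}}).
by move=> x y /eqP; rewrite tofrac_eq => /eqP.
Qed.

Lemma ideal_quot_eq0 (R : comNzRingType) (I : idealr R) x :
  (\pi_{ideal_quot I} x == 0) = (x \in I).
Proof. by rewrite -[in RHS](subr0 x) Quotient.idealrBE rmorph0. Qed.

(** The ideal [P] is prime: if $x, y \notin P$, then by maximality $P + xR$ and $P + yR$ each
    contain a positive integer, and $xy \in P$ would put the product of the two in [P]. *)
Lemma rmorphism_to_char0_field (R : comNzRingType) :
  (forall n, n.+1%:R != 0 :> R) ->
  exists (K : fieldType) (f : {rmorphism R -> K}), forall n, n.+1%:R != 0 :> K.
Proof.
move=> R0.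
have [|P [PW _ Pmax]] := @ideal_Zorn R (range (fun n => n.+1%:R))
    (ideal_mk (idealr_closed0 R)).
  by move=> x; rewrite inE => /eqP-> [n _ /eqP]; rewrite (negPf (R0 n)).
have int_in x : x \notin P -> exists n b, n.+1%:R - x * b \in P.
  move=> xP; apply/not_existsP => N.
  have [b|J [PJ xJ JP]] := @ideal_adjoin R P x.
    by apply/negP => bP; apply: (N 0%N); exists b.
  case/negP: xP; apply: (Pmax J) => // z zJ [n _ nz]; apply: (N n).
  by have [b] := JP z zJ; rewrite -nz; exists b.
have prime_P x y : x * y \in P -> (x \in P) || (y \in P).
  move=> xyP; apply/orP/or_asboolP/negPn/negP; rewrite negb_or => /andP[].
  move=> /asboolPn/negP/int_in[n [b nP]] /asboolPn/negP/int_in[m [c mP]].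
  apply: (PW (n.+1%:R * m.+1%:R)); last first.
    by exists (n.+1 * m.+1).-1; rewrite // prednK // natrM.
  have -> : n.+1%:R * m.+1%:R = m.+1%:R * (n.+1%:R - x * b)
      + (x * b) * (m.+1%:R - y * c) + (b * c) * (x * y) :> R.
    rewrite [m.+1%:R * _]mulrC mulrBl mulrBr addrA subrK.
    by rewrite [x * b * (y * c)]mulrACA [x * y * _]mulrC subrK.
  by apply: rpredD; first apply: rpredD; apply: idealMr.
have [|K [f f_inj]] := @integral_fraction {ideal_quot P}.
  move=> x y; rewrite -[x]reprK -[y]reprK -rmorphM !ideal_quot_eq0.
  by move/eqP; rewrite ideal_quot_eq0; apply: prime_P.
exists K, (f \o \pi_{ideal_quot P}) => n.
rewrite -(rmorph_nat (f \o \pi_{ideal_quot P})) /= -(rmorph0 f) (inj_eq f_inj).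
by rewrite ideal_quot_eq0; apply/negP => /PW[]; exists n.
Qed.

(** * Primes that are units, and maximal subrings missing their inverses *)

(** Otherwise $1 + rb$ generates a proper ideal, contained in a maximal ideal [M]; as $r \in M$,
    also $1 \in M$. *)
Lemma jacobson_unit (R : comNzRingType) (r b : R) :
  r \in jacobson (R := R) -> exists c, (1 + r * b) * c = 1.
Proof.
move=> rJ; apply/not_existsP => N; pose u := 1 + r * b.
have [c|J [_ uJ _]] := @ideal_adjoin R (ideal_mk (idealr_closed0 R)) u.
  by apply/negP; rewrite inE subr_eq0 => /eqP uc; apply: (N c).
have [x xJ /= x1|M [M1 JM Mmax]] := @ideal_Zorn R [set 1] J.
  by move: xJ; rewrite x1 idealr1.
have maxM : maximal_ideal M.
  by move=> I; apply: Mmax => x xI /= x1; move: xI; rewrite x1 idealr1.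
have rM : r \in M by move/asboolP: rJ; apply.
have : 1 \in M by rewrite -[1](addrK (r * b)) rpredB ?(JM u) // mulrC idealMr.
by rewrite idealr1.
Qed.

(** Bezout over the natural numbers gives $kp = ln + 1$, and the right-hand side is a unit. *)
Lemma coprime_unit (R : comNzRingType) (n p : nat) :
  n%:R \in jacobson (R := R) -> (0 < p)%N -> coprime p n ->
  exists c : R, p%:R * c = 1.
Proof.
move=> nJ p_gt0 /eqP pn; have [k l kE _] := egcdnP n p_gt0.
have [c cE] := jacobson_unit l%:R nJ; exists (k%:R * c).
by rewrite mulrA -natrM mulnC kE pn natrD natrM addrC [l%:R * _]mulrC cE.
Qed.

(** Take [T] maximal among the subrings missing [c]. A strictly larger one contains [c], hence every
    $x = c^k (a^k x)$. *)
Lemma maximal_subring_missing (R : comNzRingType) (a c : R)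
    (S : subringClosed R) : a * c = 1 -> c \notin S ->
  (forall x, exists k, a ^+ k * x \in S) ->
  exists T : subringClosed R,
    [/\ maximal_subring T, c \notin T & forall x, exists k, a ^+ k * x \in T].
Proof.
move=> ac cS aS; have [F U _ FQ UP|T [cT ST Tmax]] :=
  @subring_Zorn R [set T | c \notin T] S cS.
  by apply/negP => /UP[T /FQ /negP].
have aT x : exists k, a ^+ k * x \in T.
  by have [k kS] := aS x; exists k; apply: ST.
exists T; split=> //; split=> [|T' [x xT'] TT']; first by exists c.
apply: Tmax => //=; apply: contra xT' => cT'; have [k kT] := aT x.
rewrite -[x]mul1r -(expr1n _ k) -ac exprMn [a ^+ k * _]mulrC -mulrA.
by rewrite rpredM ?rpredX //; apply: TT'.
Qed.

Lemma preimage_subring_closed (R S : comNzRingType) (f : {rmorphism R -> S})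
  (T : subringClosed S) : GRing.subring_closed (fun x => f x \in T).
Proof.
split=> [|x y xT yT|x y xT yT]; rewrite unfold_in.
- by rewrite rmorph1 rpred1.
- by rewrite rmorphB rpredB.
- by rewrite rmorphM rpredM.
Qed.

Lemma maximal_subring_at_prime (R : comNzRingType) (p : nat) (c : R) :
  (forall n, n.+1%:R != 0 :> R) -> prime p -> p%:R * c = 1 ->
  exists T : subringClosed R, [/\ maximal_subring T, c \notin T &
    forall x, exists k, p%:R ^+ k * x \in T].
Proof.
move=> R0 p_pr pc; have [K [f K0]] := rmorphism_to_char0_field R0.
have [V [pV VK]] := field_localization (integers_prime_to_good p_pr K0).
pose S := subring_mk (preimage_subring_closed f V).
apply: (@maximal_subring_missing _ _ _ S) => //.
  apply: contra pV => fcV; suff -> : p%:R^-1 = f c by [].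
  have := congr1 f pc; rewrite rmorphM rmorph_nat rmorph1 => fpc.
  have p0 : p%:R != 0 :> K by rewrite -(prednK (prime_gt0 p_pr)).
  by apply: (mulfI p0); rewrite fpc mulfV.
move=> x; have [k kV] := VK (f x); exists k.
by rewrite unfold_in /= rmorphM rmorphXn rmorph_nat.
Qed.

(** * Distinct primes give non-isomorphic subrings *)

(** The image of [c] is again an inverse of [p], and inverses in [R] are unique, so it is [c]
    itself. *)
Lemma subring_iso_inverse (R : comNzRingType) (S T : subringClosed R)
    (p : nat) (c : R) :
  subring_iso S T -> p%:R * c = 1 -> c \in S -> c \in T.
Proof.
move=> [f _] pc cS; pose d : subring_of S := SubringOf cS.
have pd : p%:R * d = 1 by apply: val_inj; rewrite rmorphM rmorph_nat rmorph1.
have pfd : p%:R * val (f d) = 1.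
  transitivity (val (f (p%:R * d))); last by rewrite pd !rmorph1.
  by rewrite !rmorphM !rmorph_nat.
suff -> : c = val (f d) by apply: valP.
by rewrite -[LHS]mulr1 -pfd mulrCA mulrA pc mul1r.
Qed.

Theorem corollary3p13 (R : comNzRingType)
    (hR : ring_char R = 0%N)
    (hJ : ring_char {ideal_quot (@jacobson R)} <> 0%N) :
  infinite_set (@maximal_subring_classes R).
Proof.
have R0 n : n.+1%:R != 0 :> R by rewrite ring_charP hR dvd0n.
set n := ring_char _ in hJ.
have nJ : n%:R \in jacobson (R := R).
  by rewrite -ideal_quot_eq0 rmorph_nat ring_charP.
(* Primes above the nonzero [n] do not divide it, so they are units of [R]. *)
pose P := [set p | prime p /\ (n < p)%N].
have PT p : P p -> exists cT : R * subringClosed R,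
    [/\ p%:R * cT.1 = 1, maximal_subring cT.2, cT.1 \notin cT.2 &
      forall x, exists k, p%:R ^+ k * x \in cT.2].
  move=> [p_pr np]; have [||c pc] := @coprime_unit R n p nJ.
  - exact: prime_gt0.
  - by rewrite prime_coprime // gtnNdvd // lt0n; apply/eqP.
  by have [T [? ? ?]] := maximal_subring_at_prime R0 p_pr pc; exists (c, T).
have P_above m : exists2 p, P p & (m < p)%N.
  have [p mp p_pr] := prime_above (maxn n m); rewrite gtn_max in mp.
  by case/andP: mp => np mp; exists p.
(* [choice] needs a value at every natural number; [d0] serves outside [P]. *)
have [p0 /PT[d0 _] _] := P_above 0%N.
have /choice[cT cTP] : forall p, exists cT : R * subringClosed R, P p ->
    [/\ p%:R * cT.1 = 1, maximal_subring cT.2, cT.1 \notin cT.2 &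
      forall x, exists k, p%:R ^+ k * x \in cT.2].
  by move=> p; have [/PT[d dP]|NP] := pselect (P p); [exists d | exists d0].
pose h p := maximal_subring_class (cT p).2.
have h_inj : {in P &, injective h}.
  move=> p q /set_mem Pp /set_mem Pq hpq; apply/eqP/negPn/negP => pq.
  have [[pc pT cN pgen] [qc qT dN qgen]] := (cTP p Pp, cTP q Pq).
  (* Equal classes make the subring for [q] isomorphic to the one for [p], so it suffices to find
     $1/p$ in the former. *)
  have : h p (cT p).2.
    by split=> //; exists idfun; exists idfun.
  rewrite hpq => -[_ iso]; case/negP: cN; apply: (subring_iso_inverse iso pc).
  have [k kT] := qgen (cT p).1.
  have [[p_pr _] [q_pr _]] := (Pp, Pq).
  have /eqP cop : coprime p (q ^ k).
    by rewrite coprimeXr // prime_coprime // dvdn_prime2.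
  (* From $up = vq^k + 1$ follows $1/p = u - v (q^k/p)$, and $q^k/p$ lies in the subring for [q]. *)
  have [u v uE _] := egcdnP (q ^ k) (prime_gt0 p_pr).
  have upE : u%:R * p%:R = v%:R * q%:R ^+ k + 1 :> R.
    by rewrite -natrX -!natrM uE cop natrD.
  have uvE : u%:R = v%:R * (q%:R ^+ k * (cT p).1) + (cT p).1.
    transitivity (u%:R * (p%:R * (cT p).1)); first by rewrite pc mulr1.
    by rewrite mulrA upE mulrDl mul1r mulrA.
  rewrite -[(cT p).1](addKr (v%:R * (q%:R ^+ k * (cT p).1))) -uvE addrC.
  by apply: rpredB; [|apply: rpredM]; rewrite ?rpred_nat.
move=> fin; have : finite_set P.
  rewrite -(eq_finite_set (inj_card_eq h_inj)); apply: sub_finite_set fin.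
  by move=> _ [p Pp <-]; exists (cT p).2 => //; have [] := cTP p Pp.
move=> /finite_seqP[s Ps].
have [p Pp] := P_above (\max_(i <- s) i)%N.
by move: Pp; rewrite Ps /= => ps; rewrite ltnNge (leq_bigmax_seq _ ps).
Qed.
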